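(* Let $m,\hat n,\tilde n\ge 1$ be integers with $\tilde n\le\hat n$, let $n=\hat n\cdot\tilde n$, and let $A\in\mathbb{R}^{m\times n}$. Suppose that $\hat x\sim\mathcal{N}(0,I_{\hat n})$ and $\tilde x\sim\mathcal{N}(0,I_{\tilde n})$ are independent, and let $\theta>1$. Then the inequality $$\|A\|_2\ge n^{-1/2}\,\theta^{-1}\,\|A(\tilde x\otimes\hat x)\|_2$$ holds with probability at least $1-2e^{-\tilde n(\theta-\ln\theta-1)/2}$.
   Context: $\otimes$ denotes the Kronecker product, so $\tilde x\otimes\hat x\in\mathbb{R}^n$. $\|\cdot\|_2$ denotes the spectral norm of a matrix and the Euclidean norm of a vector. $\mathcal{N}(0,I_d)$ is the standard Gaussian distribution on $\mathbb{R}^d$. *)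

(* Defs.v *)
From HB Require Import structures.
From mathcomp Require Import all_boot all_order all_algebra.
From mathcomp Require Import all_classical all_reals all_analysis.
From mathcomp.real_closed Require Import mxtens.

Set Implicit Arguments.
Unset Strict Implicit.
Unset Printing Implicit Defensive.

Import Order.TTheory GRing.Theory Num.Theory.
Import numFieldNormedType.Exports.

Local Open Scope classical_set_scope.
Local Open Scope ring_scope.

(* The norm that MathComp-Analysis puts on matrices is the sup norm, so the
   Euclidean and spectral norms are defined here. *)
Definition euclid_norm (R : realType) (n : nat) (x : 'cV[R]_n) : R :=
  Num.sqrt (\sum_(i < n) x i 0 ^+ 2).

Definition spectral_norm (R : realType) (m n : nat) (A : 'M[R]_(m, n)) : R :=
  sup [set euclid_norm (A *m x) | x in [set x : 'cV[R]_n | euclid_norm x <= 1]].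

(* The ascription identifies the column dimension 1 * 1 of the Kronecker
   product [*t] with 1; entry i * q + j of [kron_col x y] is x_i y_j. *)
Definition kron_col (R : realType) (p q : nat) (x : 'cV[R]_p) (y : 'cV[R]_q) :
  'cV[R]_(p * q) := x *t y.

(* Random vectors take their values in [n.-tuple R], which the library equips
   with the product (Borel) sigma-algebra of R^n. *)
Definition col_of_tuple (R : realType) (n : nat) (t : n.-tuple R) : 'cV[R]_n :=
  \col_i tnth t i.

(* N(0, I_n) is the n-fold product of the one-dimensional N(0, 1); the product
   measure is specified by its values on measurable boxes. *)
Definition is_std_gaussian (R : realType) (n : nat)
    (mu : probability (n.-tuple R) R) : Prop :=
  forall B : 'I_n -> set R, (forall i, measurable (B i)) ->
    mu [set t | forall i, B i (tnth t i)] = (\prod_(i < n) normal_prob 0 1 (B i))%E.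

Definition independent_RV d d1 d2 (Omega : measurableType d)
    (T1 : measurableType d1) (T2 : measurableType d2) (R : realType)
    (P : probability Omega R) (X : {RV P >-> T1}) (Y : {RV P >-> T2}) : Prop :=
  forall (B : set T1) (C : set T2), measurable B -> measurable C ->
    P ((X @^-1` B) `&` (Y @^-1` C)) = (P (X @^-1` B) * P (Y @^-1` C))%E.

(* Main.v *)
Require Import Defs.
From HB Require Import structures.
From mathcomp Require Import all_boot all_order all_algebra.
From mathcomp Require Import all_classical all_reals all_analysis.
From mathcomp Require Import measurable_realfun.
From mathcomp Require Import ring lra.
From mathcomp.real_closed Require Import mxtens.

(** The Kronecker product is multiplicative for Euclidean norms, so that
    |A (xt (x) xh)| <= |A| |xt| |xh|, and the inequality can only fail when
    |xt|^2 |xh|^2 > nt nh theta^2. Then |xh|^2 > nh theta or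
    |xt|^2 > nt theta, and it suffices to bound the probabilities of these two
    events and add them up ([theorem2p3]).

    Each one is an upper tail of a chi-square law with k degrees of freedom,
    treated by Chernoff's method ([gauss_sqnorm_tail]): for lambda > 0, the
    probability of |x|^2 > k theta is at most the expectation of
    exp (lambda (|x|^2 - k theta)), a product of k equal one-dimensional
    expectations. With the optimal lambda = (1 - 1/theta)/2, tilting the
    standard normal density by exp (lambda (x^2 - theta)) gives a multiple of
    the density of N(0, theta) ([normal_tilt]), so every factor equals
    exp (- (theta - ln theta - 1)/2). The k-th power of this decreases with k,
    because theta - ln theta - 1 >= 0; as nt <= nh, both tails are bounded by
    the power with k = nt.

    A standard Gaussian vector is specified by the measures of boxes only.
    Passing from boxes to expectations of products of functions of the
    coordinates is [integral_prod_box], which replaces the indicator functions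
    by arbitrary nonnegative functions one coordinate at a time. *)

Set Implicit Arguments.
Unset Strict Implicit.
Unset Printing Implicit Defensive.

Import Order.TTheory GRing.Theory Num.Theory.
Import numFieldNormedType.Exports.

Local Open Scope classical_set_scope.
Local Open Scope ring_scope.

(** * Euclidean and spectral norms *)

Lemma euclid_norm_ge0 (R : realType) n (x : 'cV[R]_n) : 0 <= euclid_norm x.
Proof. exact: sqrtr_ge0. Qed.

Lemma euclid_norm0 (R : realType) n : euclid_norm (0 : 'cV[R]_n) = 0.
Proof. by rewrite /euclid_norm big1 ?sqrtr0// => i _; rewrite mxE expr0n. Qed.

Lemma euclid_norm_sqr (R : realType) n (x : 'cV[R]_n) :
  euclid_norm x ^+ 2 = \sum_(i < n) x i 0 ^+ 2.
Proof. by rewrite sqr_sqrtr// sumr_ge0// => i _; exact: sqr_ge0. Qed.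

Lemma euclid_normZ (R : realType) n (a : R) (x : 'cV[R]_n) :
  0 <= a -> euclid_norm (a *: x) = a * euclid_norm x.
Proof.
move=> a0; apply/eqP; rewrite -(@eqrXn2 _ 2) ?mulr_ge0 ?euclid_norm_ge0//.
rewrite exprMn !euclid_norm_sqr mulr_sumr; apply/eqP/eq_bigr => i _.
by rewrite mxE exprMn.
Qed.

Lemma euclid_norm_kron (R : realType) p q (x : 'cV[R]_p) (y : 'cV[R]_q) :
  euclid_norm (kron_col x y) = euclid_norm x * euclid_norm y.
Proof.
apply/eqP; rewrite -(@eqrXn2 _ 2) ?mulr_ge0 ?euclid_norm_ge0//.
rewrite exprMn !euclid_norm_sqr mulr_sum; apply/eqP/eq_bigr => i _.
by rewrite /kron_col mxE exprMn !ord1.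
Qed.

Lemma coord_le_euclid_norm (R : realType) n (x : 'cV[R]_n) i :
  `|x i 0| <= euclid_norm x.
Proof.
rewrite -(@ler_pXn2r _ 2) ?nnegrE ?euclid_norm_ge0// euclid_norm_sqr.
rewrite real_normK ?num_real// (bigD1 i)//= lerDl sumr_ge0// => j _.
exact: sqr_ge0.
Qed.

(** The supremum of a set without upper bound is a junk value, so the
    defining property of the spectral norm rests on this crude entrywise
    estimate. *)
Lemma has_ubound_unit_ball_image (R : realType) m n (A : 'M[R]_(m, n)) :
  has_ubound
    [set euclid_norm (A *m x) | x in [set x : 'cV[R]_n | euclid_norm x <= 1]].
Proof.
exists (Num.sqrt (\sum_(i < m) (\sum_(j < n) `|A i j|) ^+ 2)) => _ [x /= x1 <-].
apply: ler_wsqrtr; apply: ler_sum => i _.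
rewrite -[leLHS](real_normK (num_real _)).
rewrite ler_pXn2r ?nnegrE ?sumr_ge0// mxE.
apply: (le_trans (ler_norm_sum _ _ _)); apply: ler_sum => j _.
rewrite normrM ler_piMr//; exact: le_trans (coord_le_euclid_norm _ _) x1.
Qed.

Lemma spectral_norm_ge0 (R : realType) m n (A : 'M[R]_(m, n)) :
  0 <= spectral_norm A.
Proof.
apply: (le_trans (euclid_norm_ge0 (A *m 0))).
apply: (ub_le_sup (has_ubound_unit_ball_image A)).
by exists 0; rewrite //= euclid_norm0.
Qed.

Lemma spectral_norm_bound (R : realType) m n (A : 'M[R]_(m, n)) (x : 'cV[R]_n) :
  euclid_norm (A *m x) <= spectral_norm A * euclid_norm x.
Proof.
have [x0|x0] := eqVneq (euclid_norm x) 0.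
  suff -> : x = 0.
    by rewrite mulmx0 !euclid_norm0 mulr0.
  apply/colP => i; rewrite mxE; apply/eqP; rewrite -normr_le0 -x0.
  exact: coord_le_euclid_norm.
have xgt0 : 0 < euclid_norm x by rewrite lt_def x0 euclid_norm_ge0.
rewrite -ler_pdivrMr// mulrC -euclid_normZ ?invr_ge0 ?euclid_norm_ge0//.
rewrite scalemxAr; apply: (ub_le_sup (has_ubound_unit_ball_image A)).
by eexists => //=; rewrite euclid_normZ ?invr_ge0 ?euclid_norm_ge0// mulVf.
Qed.

(** * Integrals determined by the measures of boxes *)

Section integral_from_sets.
Import HBNNSimple.
Local Open Scope ereal_scope.

(** Both sides are additive and continuous along increasing sequences in g,
    so the case of indicator functions, which is the hypothesis, extends to
    simple functions and then, by monotone convergence, to all nonnegative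
    measurable functions. Taking Y as a coordinate and h as the product of
    functions of the other coordinates frees one coordinate at a time; taking
    Y as the identity, h is a density of nu with respect to mu. *)
Lemma integral_indic_transfer d d' (T : measurableType d) (T' : measurableType d')
    (R : realType) (mu : {measure set T -> \bar R})
    (nu : {measure set T' -> \bar R}) (Y : T -> T') (h : T -> R) :
    measurable_fun [set: T] Y -> measurable_fun [set: T] h ->
    (forall t, 0 <= h t)%R ->
    (forall B, measurable B -> \int[mu]_t (\1_B (Y t) * h t)%:E = nu B) ->
  forall g : T' -> R, measurable_fun [set: T'] g -> (forall y, 0 <= g y)%R ->
    \int[mu]_t (g (Y t) * h t)%:E = \int[nu]_y (g y)%:E.
Proof.
move=> mY mh h0 hB g mg g0.
have mEg : measurable_fun [set: T'] (fun y => (g y)%:E) by exact/measurable_EFinP.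
pose s := nnsfun_approx measurableT mEg.
have sg y : (EFin \o s^~ y) @ \oo --> (g y)%:E.
  by apply: cvg_nnsfun_approx => // ? _; rewrite lee_fin.
have nds y : {homo (fun n => s n y) : a b / (a <= b)%N >-> (a <= b)%R}.
  by move=> a b ab; exact/lefP/nd_nnsfun_approx.
transitivity (limn (fun n => \int[nu]_y (s n y)%:E)); last first.
  rewrite -monotone_convergence//.
  - by apply: eq_integral => y _; apply/cvg_lim => //; exact: sg.
  - by move=> n; exact/measurable_EFinP.
  - by move=> n y _; rewrite lee_fin.
  - by move=> y _ a b ab; rewrite lee_fin; exact: nds.
transitivity (limn (fun n => \int[mu]_t (s n (Y t) * h t)%:E)).
  rewrite -monotone_convergence//.
  - apply: eq_integral => t _; apply/esym/cvg_lim => //.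
    under eq_fun do rewrite EFinM.
    by rewrite EFinM; apply: cvgeZr => //; exact: sg.
  - move=> n; apply/measurable_EFinP/measurable_funM => //.
    by apply: measurableT_comp.
  - by move=> n y _; rewrite lee_fin mulr_ge0.
  - by move=> y _ a b ab; rewrite lee_fin ler_wpM2r//; exact: nds.
congr (limn _); apply/funext => n.
have mhB r : measurable_fun [set: T]
    (fun t => (\1_(s n @^-1` [set r]) (Y t) * h t)%:E).
  apply/measurable_EFinP/measurable_funM => //.
  by apply: (measurableT_comp _ mY); exact: measurable_indic.
transitivity (\int[mu]_t (\sum_(r \in range (s n))
    r%:E * (\1_(s n @^-1` [set r]) (Y t) * h t)%:E)).
  apply: eq_integral => t _; rewrite [in LHS]fimfunE EFinM -fsumEFin//.
  rewrite ge0_mule_fsuml => [|r]; last exact: nnfun_muleindic_ge0.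
  by apply: eq_fsbigr => r _; rewrite -!EFinM mulrA.
rewrite ge0_integral_fsum//; last 2 first.
- by move=> r; exact: measurable_funeM.
- move=> r t _; rewrite -EFinM mulrA EFinM mule_ge0 ?lee_fin//.
  by rewrite -lee_fin; exact: nnfun_muleindic_ge0.
rewrite integralT_nnsfun sintegralE; apply: eq_fsbigr => r /[!inE] -[y _ <-].
rewrite ge0_integralZl//.
- by rewrite hB.
- by move=> t _; rewrite lee_fin mulr_ge0.
- by rewrite lee_fin.
Qed.

Lemma integral_normal_prob_density (R : realType) (m s : R) (g : R -> R) :
    measurable_fun [set: R] g -> (forall y, 0 <= g y)%R ->
  \int[normal_prob m s]_x (g x)%:E =
  \int[lebesgue_measure]_x (g x * normal_pdf m s x)%:E.
Proof.
move=> mg g0.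
rewrite -(@integral_indic_transfer _ _ _ _ _ lebesgue_measure _ idfun
            (normal_pdf m s))//.
- exact: measurable_id.
- exact: measurable_normal_pdf.
- by move=> x; exact: normal_pdf_ge0.
- move=> B mB; rewrite /= /normal_prob [RHS]integral_mkcond.
  apply: eq_integral => x _; rewrite patchE indicE.
  by case: ifPn; rewrite ?mul1r ?mul0r.
Qed.

(** The hypothesis is the case where all functions are indicators. With the
    other functions fixed, both sides depend on the function of one coordinate
    as integrals do, and [integral_indic_transfer] replaces its indicator by an
    arbitrary function; this is done for each coordinate in turn. *)
Lemma integral_prod_box d d' (T : measurableType d) (T' : measurableType d')
    (R : realType) (mu : {measure set T -> \bar R}) (nu : probability T' R)
    n (X : 'I_n -> T -> T') (g : 'I_n -> T' -> R) (c : 'I_n -> R) :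
    (forall i, measurable_fun [set: T] (X i)) ->
    (forall B : 'I_n -> set T', (forall i, measurable (B i)) ->
       mu [set t | forall i, B i (X i t)] = \prod_(i < n) nu (B i)) ->
    (forall i, measurable_fun [set: T'] (g i)) ->
    (forall i y, 0 <= g i y)%R ->
    (forall i, \int[nu]_y (g i y)%:E = (c i)%:E) ->
  \int[mu]_t (\prod_(i < n) g i (X i t))%:E = (\prod_(i < n) c i)%:E.
Proof.
move=> mX box mg g0 gc.
have c0 f k (f0 : forall y, (0 <= f y)%R) :
    \int[nu]_y (f y)%:E = k%:E -> (0 <= k)%R.
  by move=> fk; rewrite -lee_fin -fk; apply: integral_ge0 => y _; rewrite lee_fin.
(* Induction on the number k of leading coordinates whose function is
   arbitrary, the functions of the others being indicators. *)
suff /(_ n g c) : forall k (g : 'I_n -> T' -> R) (c : 'I_n -> R),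
    (forall i, measurable_fun [set: T'] (g i)) ->
    (forall i y, 0 <= g i y)%R ->
    (forall i, \int[nu]_y (g i y)%:E = (c i)%:E) ->
    (forall i : 'I_n, (k <= i)%N -> exists2 B, measurable B & g i = \1_B) ->
    \int[mu]_t (\prod_(i < n) g i (X i t))%:E = (\prod_(i < n) c i)%:E.
  by apply => // i; rewrite leqNgt ltn_ord.
elim=> [|k IH] {mg g0 gc} {}g {}c mg g0 gc indg.
  have [B mB gB] : exists2 B : 'I_n -> set T',
      (forall i, measurable (B i)) & forall i, g i = \1_(B i).
    have /choice[B HB] i : exists B, measurable B /\ g i = \1_B.
      by have [//|B] := indg i _; exists B.
    by exists B => i; case: (HB i).
  transitivity (\int[mu]_t (\1_[set t | forall i, B i (X i t)] t)%:E).
    apply: eq_integral => t _; congr EFin; rewrite indicE.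
    have [/set_mem/= Bt|/negP Bt] := boolP (t \in _).
      by rewrite big1// => i _; rewrite gB indicE mem_set.
    have /existsNP[i Bi] : ~ forall i, B i (X i t).
      by move=> H; apply: Bt; rewrite inE.
    by rewrite (bigD1 i)//= gB indicE memNset// mul0r.
  have mS : measurable [set t | forall i, B i (X i t)].
    rewrite [X in measurable X](_ : _ = \bigcap_(i in [set: 'I_n]) X i @^-1` B i).
      apply: fin_bigcap_measurable => // i _.
      by rewrite -[X in measurable X]setTI; exact: mX.
    by apply/seteqP; split=> [t Bt i _|t Bt i]; exact: Bt.
  rewrite integral_indic// setIT box// (big_morph EFin EFinM erefl).
  apply: eq_bigr => i _.
  by rewrite -gc gB integral_indic// setIT.
have [nk|kn] := leqP n k.
  by apply: IH => // i ki; have := ltn_ord i; rewrite ltnNge (leq_trans nk ki).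
(* Coordinate k is freed with the functions of all the others fixed. *)
pose j := Ordinal kn.
pose h t := (\prod_(i < n | i != j) g i (X i t))%R.
have h0 t : (0 <= h t)%R by exact: prodr_ge0.
have cj0 : (0 <= \prod_(i < n | i != j) c i)%R.
  by apply: prodr_ge0 => i _; exact: c0 (gc i).
have mh : measurable_fun [set: T] h.
  rewrite /h; under eq_fun do rewrite big_mkcond/=.
  apply: measurable_prod => i _; case: (i != j) => //.
  exact: measurableT_comp.
under eq_integral do rewrite (bigD1 j)//= -/(h _).
rewrite (@integral_indic_transfer _ _ _ _ _ mu (mscale (NngNum cj0) nu) (X j) h)//.
- rewrite ge0_integral_mscale//=.
  + by rewrite gc [in RHS](bigD1 j)//= -EFinM mulrC.
  + exact/measurable_EFinP.
  + by move=> y _; rewrite lee_fin.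
- move=> B mB.
  change (\int[mu]_t (\1_B (X j t) * h t)%:E =
          (\prod_(i < n | i != j) c i)%:E * nu B).
  pose g' i := if i == j then \1_B else g i.
  pose c' i := if i == j then fine (nu B) else c i.
  have c'E : (\prod_(i < n) c' i = fine (nu B) * \prod_(i < n | i != j) c i)%R.
    rewrite (bigD1 j)//= {1}/c' eqxx; congr (_ * _)%R.
    by apply: eq_bigr => i /negPf ij; rewrite /c' ij.
  rewrite muleC -[X in X * _]fineK ?fin_num_measure// -EFinM -c'E -(IH g').
  + apply: eq_integral => t _; rewrite (bigD1 j)//= {1}/g' eqxx.
    by congr (_ * _)%:E; apply: eq_bigr => i /negPf ij; rewrite /g' ij.
  + by move=> i; rewrite /g'; case: ifP => // _; exact: measurable_indic.
  + by move=> i y; rewrite /g'; case: ifP.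
  + move=> i; rewrite /g' /c'; case: ifP => // _.
    by rewrite integral_indic// setIT fineK// fin_num_measure.
  + move=> i ki; rewrite /g'; case: ifPn => [_|ij]; first by exists B.
    by apply: indg; rewrite ltn_neqAle ki andbT eq_sym.
Qed.

End integral_from_sets.

(** * Chernoff bound for the norm of a Gaussian vector *)

Lemma sqrt_expR_ln (R : realType) (a : R) : 0 < a ->
  Num.sqrt a = expR (ln a / 2).
Proof.
move=> a0; rewrite -(ger0_norm (expR_ge0 (ln a / 2))) -sqrtr_sqr.
by rewrite -expRM_natr divfK// lnK// posrE.
Qed.

(** Completing the exponent: -x^2/2 + (1 - 1/theta) x^2/2 = -x^2/(2 theta),
    and passing from the normalization of N(0, 1) to that of N(0, theta)
    costs the factor sqrt theta = exp (ln theta / 2); the factor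
    exp (- (theta - 1)/2) comes from the constant term of the tilt. *)
Lemma normal_tilt (R : realType) (theta x : R) : 0 < theta ->
  expR ((1 - theta^-1) / 2 * (x ^+ 2 - theta)) * normal_pdf 0 1 x =
  expR (- ((theta - ln theta - 1) / 2)) * normal_pdf 0 (Num.sqrt theta) x.
Proof.
move=> t0; have s0 : 0 < Num.sqrt theta by rewrite sqrtr_gt0.
rewrite !normal_pdfE ?oner_eq0 ?gt_eqF// /normal_peak /normal_fun !subr0.
rewrite sqr_sqrtr ?ltW// expr1n mul1r -mulrnAr sqrtrM ?ltW// invfM.
rewrite /= [LHS]mulrCA [in RHS](mulrC _^-1) -[in RHS]mulrA [RHS]mulrCA.
rewrite (sqrt_expR_ln t0) -expRN -!expRD; congr (_ * expR _); field.
by rewrite gt_eqF.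
Qed.

Lemma measurable_le_cst d (T : measurableType d) (R : realType) (f : T -> R)
  (c : R) : measurable_fun [set: T] f -> measurable [set w | f w <= c].
Proof.
move=> mf; have := mf measurableT _ (measurable_itv `]-oo, c]).
by rewrite setTI; congr measurable.
Qed.

Lemma measurable_gt_cst d (T : measurableType d) (R : realType) (f : T -> R)
  (c : R) : measurable_fun [set: T] f -> measurable [set w | c < f w].
Proof.
move=> mf; have := mf measurableT _ (measurable_itv `]c, +oo[).
rewrite setTI; congr measurable.
by apply/seteqP; split=> w; rewrite /= in_itv/= andbT.
Qed.

Lemma measurable_sqnorm (R : realType) n :
  measurable_fun [set: n.-tuple R] (fun t => \sum_(i < n) tnth t i ^+ 2).
Proof.
apply: measurable_sum => i; apply: measurable_funX.
exact: measurable_tnth.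
Qed.

Lemma gauss_tilt_integral (R : realType) (theta : R) : 0 < theta ->
  (\int[normal_prob 0 1]_x (expR ((1 - theta^-1) / 2 * (x ^+ 2 - theta)))%:E =
   (expR (- ((theta - ln theta - 1) / 2)))%:E)%E.
Proof.
move=> t0; rewrite integral_normal_prob_density.
- under eq_integral do rewrite normal_tilt// EFinM.
  rewrite ge0_integralZl_EFin ?expR_ge0//.
  + by rewrite integral_normal_pdf mule1.
  + by move=> x _; rewrite lee_fin normal_pdf_ge0.
  + by apply/measurable_EFinP; exact: measurable_normal_pdf.
- apply: measurableT_comp => //; apply: measurable_funM => //.
  by apply: measurable_funB => //; exact: measurable_funX.
- by move=> x; exact: expR_ge0.
Qed.

(** Chernoff's bound; the parameter (1 - theta^-1)/2 minimizes
    exp (- lambda theta) / sqrt (1 - 2 lambda), the expectation of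
    exp (lambda (x^2 - theta)) for a standard normal x. *)
Lemma gauss_sqnorm_tail (R : realType) n (mu : probability (n.-tuple R) R)
    (theta : R) : is_std_gaussian mu -> 1 < theta ->
  (mu [set t | (n%:R * theta < \sum_(i < n) tnth t i ^+ 2)%R] <=
   (expR (- (n%:R * (theta - ln theta - 1) / 2)))%:E)%E.
Proof.
move=> gauss t1; have t0 : 0 < theta by rewrite (lt_trans ltr01).
pose g (x : R) := expR ((1 - theta^-1) / 2 * (x ^+ 2 - theta)).
have mg : measurable_fun [set: R] g.
  apply: measurableT_comp => //; apply: measurable_funM => //.
  by apply: measurable_funB => //; exact: measurable_funX.
have mE : measurable [set t : n.-tuple R |
    (n%:R * theta < \sum_(i < n) tnth t i ^+ 2)%R].
  by apply: measurable_gt_cst; exact: measurable_sqnorm.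
have -> : expR (- (n%:R * (theta - ln theta - 1) / 2)) =
    \prod_(i < n) expR (- ((theta - ln theta - 1) / 2)).
  by rewrite prodr_const card_ord -expRM_natl mulrN mulrA.
rewrite -(@integral_prod_box _ _ _ _ _ mu (normal_prob 0 1) n
            (fun i t => tnth t i) (fun=> g)).
- (* The exponential dominates the indicator function of the tail event. *)
  rewrite -[X in mu X]setIT -integral_indic//.
  apply: ge0_le_integral => //.
  + by apply/measurable_EFinP; exact: measurable_indic.
  + apply/measurable_EFinP; apply: measurable_prod => i _.
    by apply: measurableT_comp => //; exact: measurable_tnth.
  move=> t _; rewrite lee_fin -expR_sum indicE.
  have [/set_mem/= tE|_] := boolP (t \in _); last exact: expR_ge0.
  rewrite -[leLHS]expR0 ler_expR -mulr_sumr mulr_ge0//.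
    by rewrite divr_ge0// subr_ge0 invf_le1// ltW.
  by rewrite sumrB sumr_const card_ord -mulr_natl subr_ge0 ltW.
- by move=> i; exact: measurable_tnth.
- by move=> B mB; exact: gauss.
- by move=> i; exact: mg.
- by move=> i y; exact: expR_ge0.
- by move=> i; exact: gauss_tilt_integral.
Qed.

(** * The random inequality *)

Lemma measurable_euclid_norm_kron d (T : measurableType d) (R : realType)
    m p q (A : 'M[R]_(m, p * q)) (X : T -> p.-tuple R) (Y : T -> q.-tuple R) :
  measurable_fun [set: T] X -> measurable_fun [set: T] Y ->
  measurable_fun [set: T] (fun w =>
    euclid_norm (A *m kron_col (col_of_tuple (X w)) (col_of_tuple (Y w)))).
Proof.
move=> mX mY; rewrite /euclid_norm.
apply: (measurableT_comp (continuous_measurable_fun (@sqrt_continuous R))).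
apply: measurable_sum => i; apply: measurable_funX.
under eq_fun do rewrite mxE.
apply: measurable_sum => j; apply: measurable_funM => //.
under eq_fun do rewrite !mxE.
by apply: measurable_funM; apply: (measurableT_comp (measurable_tnth _)).
Qed.

Lemma euclid_norm_col_of_tuple (R : realType) n (t : n.-tuple R) :
  euclid_norm (col_of_tuple t) = Num.sqrt (\sum_(i < n) tnth t i ^+ 2).
Proof. by congr Num.sqrt; apply: eq_bigr => i _; rewrite mxE. Qed.

Theorem theorem2p3 (R : realType) (d : measure_display)
    (Omega : measurableType d) (P : probability Omega R)
    (m nh nt : nat) (m_ge1 : (1 <= m)%N) (nh_ge1 : (1 <= nh)%N)
    (nt_ge1 : (1 <= nt)%N) (nt_le_nh : (nt <= nh)%N)
    (A : 'M[R]_(m, nt * nh))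
    (xh : {RV P >-> nh.-tuple R}) (xt : {RV P >-> nt.-tuple R})
    (xh_gauss : is_std_gaussian (distribution P xh))
    (xt_gauss : is_std_gaussian (distribution P xt))
    (xh_xt_indep : independent_RV xh xt)
    (theta : R) (theta_gt1 : 1 < theta) :
  ((1 - 2 * expR (- (nt%:R * (theta - ln theta - 1) / 2)))%:E <=
   P [set w | (spectral_norm A >=
               (nt * nh)%:R `^ (- 2^-1) * theta^-1 *
               euclid_norm (A *m kron_col (col_of_tuple (xt w))
                                          (col_of_tuple (xh w))))%R])%E.
Proof.
have t0 : 0 < theta by rewrite (lt_trans ltr01).
pose big n (t : n.-tuple R) := n%:R * theta < \sum_(i < n) tnth t i ^+ 2.
have mbig n (X : {RV P >-> n.-tuple R}) : measurable [set w | big n (X w)].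
  apply: measurable_gt_cst.
  by apply: (measurableT_comp (@measurable_sqnorm R n)).
set E := [set w | _]; set e := expR _.
have mE : measurable E.
  apply: measurable_le_cst; apply: measurable_funM => //.
  exact: measurable_euclid_norm_kron.
have subE : ~` E `<=` [set w | big nh (xh w)] `|` [set w | big nt (xt w)].
  move=> w /= Ew; apply: contrapT => /not_orP[/negP h1 /negP h2]; apply: Ew.
  move: h1 h2; rewrite /big -!leNgt => h1 h2; rewrite /E/=.
  have N0 : 0 < (nt * nh)%:R :> R by rewrite ltr0n muln_gt0 nt_ge1.
  rewrite powRN powR12_sqrt ?ler0n// -invfM ler_pdivrMl; last first.
    by rewrite mulr_gt0// sqrtr_gt0.
  rewrite mulrC.
  apply: (le_trans (spectral_norm_bound _ _)).
  apply: ler_wpM2l; first exact: spectral_norm_ge0.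
  rewrite euclid_norm_kron !euclid_norm_col_of_tuple.
  rewrite -sqrtrM; last by apply: sumr_ge0 => i _; exact: sqr_ge0.
  rewrite -[theta in leRHS](ger0_norm (ltW t0)) -sqrtr_sqr -sqrtrM ?ler0n//.
  apply: ler_wsqrtr; rewrite natrM expr2 mulrACA.
  by apply: ler_pM => //; apply: sumr_ge0 => i _; exact: sqr_ge0.
have rate0 : 0 <= theta - ln theta - 1.
  have : ln (1 + (theta - 1)) <= theta - 1 by apply: le_ln1Dx; lra.
  by rewrite (addrC 1) subrK; lra.
have Eh : (P [set w | big nh (xh w)] <= e%:E)%E.
  apply: (le_trans (gauss_sqnorm_tail xh_gauss theta_gt1)).
  by rewrite lee_fin ler_expR lerN2 ler_pM2r// ler_wpM2r// ler_nat.
have Et : (P [set w | big nt (xt w)] <= e%:E)%E.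
  exact: (gauss_sqnorm_tail xt_gauss theta_gt1).
have CE : (P (~` E) <= (2 * e)%:E)%E.
  apply: (@le_trans _ _ (P ([set w | big nh (xh w)] `|` [set w | big nt (xt w)]))).
    apply: le_measure => //; rewrite inE; first exact: measurableC.
    by apply: measurableU; exact: mbig.
  apply: (le_trans (measureU2 _ _ _)) => //.
  by rewrite mulr_natl mulr2n EFinD; exact: leeD.
rewrite -(setCK E) (probability_setC P (measurableC mE)).
by rewrite EFinB leeB.
Qed.
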